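(* Let $P_{10}:(\sigma,\mu)$ be a strong fuzzy graph whose underlying crisp graph is the Petersen graph (on 10 vertices) and such that $\sigma$ is a $c$-constant function. Then $P_{10}$ is *-balanced.
   Context: A fuzzy graph $G:(\sigma,\mu)$ consists of a finite non-empty vertex set $V$, a function $\sigma:V\to(0,1]$, and a symmetric function $\mu:V\times V\to[0,1]$ with $\mu(u,v)\le \sigma(u)\wedge\sigma(v)$ for all $u,v$, where $\wedge$ denotes minimum. There are no loops: all conditions and sums over pairs $u,v\in V$ range over unordered pairs $\{u,v\}$ of distinct vertices. The underlying crisp graph of $G$ has vertex set $V$ and edge set $E=\{\{u,v\}:\mu(u,v)>0\}$. $G$ is strong if $\mu(u,v)=\sigma(u)\wedge\sigma(v)$ for all $\{u,v\}\in E$. $\sigma$ is a $c$-constant function if $\sigma(v)=c$ for all $v\in V$ (so $c\in(0,1]$). The *-density of $G$ is $D^{\ast}(G)=\dfrac{2\sum_{u,v\in V}\mu(u,v)}{\sum_{u\in V}\sigma(u)}$. A non-empty fuzzy subgraph of $G$ is a fuzzy graph $H:(\sigma',\mu')$ on a non-empty set $W\subseteq V$ with $\sigma'(u)\le\sigma(u)$ and $\mu'(u,v)\le\mu(u,v)$ for all $u,v\in W$. $G$ is *-balanced if $D^{\ast}(H)\le D^{\ast}(G)$ for all non-empty fuzzy subgraphs $H$ of $G$. *)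

(* Defs.v *)
From HB Require Import structures.
From mathcomp Require Import all_boot all_order all_algebra.
From mathcomp Require Import reals.
Set Implicit Arguments.
Unset Strict Implicit.
Unset Printing Implicit Defensive.
Import Order.TTheory GRing.Theory Num.Theory.
Local Open Scope ring_scope.

(* There are no loops: the values [mu v v] are irrelevant, and every condition
   or sum below that relates two vertices is restricted to distinct ones. *)
Record fuzzy_graph (R : realType) (V : finType) := FuzzyGraph {
  sigma : V -> R;
  mu : V -> V -> R;
  fg_nonempty : (0 < #|V|)%N;
  sigma_range : forall v, 0 < sigma v <= 1;
  mu_range : forall u v, 0 <= mu u v <= 1;
  mu_sym : forall u v, mu u v = mu v u;
  mu_le_min : forall u v, u != v -> mu u v <= Num.min (sigma u) (sigma v)
}.

Definition crisp_edge (R : realType) (V : finType) (G : fuzzy_graph R V) :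
    rel V :=
  fun u v => (u != v) && (0 < mu G u v).

Definition strong (R : realType) (V : finType) (G : fuzzy_graph R V) : Prop :=
  forall u v, crisp_edge G u v -> mu G u v = Num.min (sigma G u) (sigma G v).

Definition sigma_constant (R : realType) (V : finType) (G : fuzzy_graph R V)
    (c : R) : Prop :=
  forall v, sigma G v = c.

(* Each unordered pair {u, v} of distinct vertices is counted once, through its
   representative that is increasing in the enumeration of V; as [mu] is
   symmetric the choice of representative is immaterial (see [mu_totalE]). *)
Definition mu_total (R : realType) (V : finType) (G : fuzzy_graph R V) : R :=
  \sum_(u : V) \sum_(v : V | (enum_rank u < enum_rank v)%N) mu G u v.

Lemma mu_totalE (R : realType) (V : finType) (G : fuzzy_graph R V) :
  2 * mu_total G = \sum_(u : V) \sum_(v : V | u != v) mu G u v.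
Proof.
have -> : 2 * mu_total G = mu_total G + mu_total G by rewrite mulr_natl mulr2n.
have {2}-> : mu_total G =
    \sum_(u : V) \sum_(v : V | (enum_rank v < enum_rank u)%N) mu G u v.
  rewrite /mu_total (exchange_big_dep xpredT) //=.
  by apply: eq_bigr => u _; apply: eq_bigr => v _; rewrite mu_sym.
rewrite -big_split /=; apply: eq_bigr => u _.
rewrite [RHS](bigID (fun v => (enum_rank u < enum_rank v)%N)) /=.
have ne v : (u != v) = (enum_rank u != enum_rank v :> nat).
  by rewrite (inj_eq val_inj) (inj_eq enum_rank_inj).
by congr (_ + _); apply: eq_bigl => v; rewrite ne; case: ltngtP.
Qed.

Definition star_density (R : realType) (V : finType) (G : fuzzy_graph R V) : R :=
  2 * mu_total G / \sum_(u : V) sigma G u.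

(* W is non-empty because H, being a fuzzy graph on W, has a vertex. *)
Definition fuzzy_subgraph (R : realType) (V : finType) (W : {set V})
    (H : fuzzy_graph R {v : V | v \in W}) (G : fuzzy_graph R V) : Prop :=
  (forall u, sigma H u <= sigma G (val u)) /\
  (forall u v, u != v -> mu H u v <= mu G (val u) (val v)).

Definition star_balanced (R : realType) (V : finType) (G : fuzzy_graph R V) :
    Prop :=
  forall (W : {set V}) (H : fuzzy_graph R {v : V | v \in W}),
    fuzzy_subgraph H G -> star_density H <= star_density G.

Definition graph_isomorphic (V1 V2 : finType) (e1 : rel V1) (e2 : rel V2) :
    Prop :=
  exists2 f : V1 -> V2, bijective f & forall u v, e2 (f u) (f v) = e1 u v.

(* The Petersen graph as the Kneser graph K(5, 2): its vertices are the ten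
   2-element subsets of {0, ..., 4}, and adjacency is disjointness. *)
Definition petersen_vertex : finType := {A : {set 'I_5} | #|A| == 2%N}.

Definition petersen_edge : rel petersen_vertex :=
  fun A B => [disjoint val A & val B].

Definition is_petersen (V : finType) (e : rel V) : Prop :=
  graph_isomorphic e petersen_edge.

(* Main.v *)
Require Import Defs.
From mathcomp Require Import all_boot all_order all_algebra.
From mathcomp Require Import reals.
Set Implicit Arguments.
Unset Strict Implicit.
Unset Printing Implicit Defensive.
Import Order.TTheory GRing.Theory Num.Theory.
Local Open Scope ring_scope.

(** The *-density is bounded by the maximum degree: in any fuzzy graph, the
    row sum of [mu] at a vertex [u] has at most [d] non-zero terms, where [d]
    bounds the crisp degrees, and each of them is at most [sigma u]; hence
    twice the total edge weight is at most [d] times the total vertex weight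
    ([star_density_le_degree]).  Passing to a fuzzy subgraph can only lose crisp
    edges, so all fuzzy subgraphs of [G] obey the bound given by [G].  If [G] is
    strong with constant [sigma] and its crisp graph is [d]-regular, every
    inequality above is an equality and [G] itself attains the bound
    ([star_density_regular]).  The Petersen graph is 3-regular: the vertices
    adjacent to a 2-subset of a 5-element set are the 'C(3, 2) = 3 subsets of
    size 2 of its complement. *)

Lemma sum_sigma_gt0 (R : realType) (V : finType) (G : fuzzy_graph R V) :
  0 < \sum_u sigma G u.
Proof.
have /card_gt0P[u0 _] := fg_nonempty G.
have sigma_gt0 u : 0 < sigma G u by case/andP: (sigma_range G u).
rewrite (bigD1 u0) //= ltr_wpDr // sumr_ge0 // => u _.
exact: ltW.
Qed.

(** As [mu] is non-negative, a pair that is not a crisp edge has weight zero. *)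
Lemma mu_totalE_edge (R : realType) (V : finType) (G : fuzzy_graph R V) :
  2 * mu_total G = \sum_u \sum_(v | crisp_edge G u v) mu G u v.
Proof.
rewrite mu_totalE; apply: eq_bigr => u _.
rewrite (bigID (fun v => 0 < mu G u v)) /= [X in _ + X]big1 ?addr0 // => v.
case/andP=> _; rewrite -leNgt => mu_le0; apply/eqP.
by rewrite eq_le mu_le0; case/andP: (mu_range G u v).
Qed.

(** In the row of [u], each edge is charged to [sigma u], one of the two bounds
    on its weight; the vertex weights may therefore vary, as they do in a fuzzy
    subgraph of a graph with constant [sigma]. *)
Lemma star_density_le_degree (R : realType) (V : finType)
    (G : fuzzy_graph R V) (d : nat) :
  (forall u, #|crisp_edge G u| <= d)%N -> star_density G <= d%:R.
Proof.
move=> deg_le; rewrite /star_density ler_pdivrMr ?sum_sigma_gt0 //.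
rewrite mu_totalE_edge mulr_sumr; apply: ler_sum => u _.
have [sigma_gt0 _] := andP (sigma_range G u).
apply: (@le_trans _ _ (\sum_(v | crisp_edge G u v) sigma G u)).
  apply: ler_sum => v /andP[neq_uv _].
  by apply: le_trans (mu_le_min G neq_uv) _; rewrite ge_min lexx.
by rewrite sumr_const mulr_natl ler_wpMn2l ?deg_le ?ltW.
Qed.

Lemma star_density_regular (R : realType) (V : finType)
    (G : fuzzy_graph R V) (c : R) (d : nat) :
    strong G -> sigma_constant G c -> (forall u, #|crisp_edge G u| = d) ->
  star_density G = d%:R.
Proof.
move=> strongG sigma_c deg.
have sum_gt0 := sum_sigma_gt0 G.
apply/eqP; rewrite /star_density -(inj_eq (mulIf (lt0r_neq0 sum_gt0))).
rewrite divfK ?lt0r_neq0 // mu_totalE_edge mulr_sumr; apply/eqP.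
apply: eq_bigr => u _; rewrite sigma_c.
transitivity (\sum_(v | crisp_edge G u v) c).
  by apply: eq_bigr => v /strongG ->; rewrite !sigma_c minxx.
by rewrite sumr_const deg mulr_natl.
Qed.

(** A pair with positive weight in [H] has positive weight in [G], so the
    inclusion of [W] embeds the neighbourhood of [u] in [H] into that in [G]. *)
Lemma crisp_degree_subgraph (R : realType) (V : finType) (W : {set V})
    (H : fuzzy_graph R {v : V | v \in W}) (G : fuzzy_graph R V) u :
  fuzzy_subgraph H G -> (#|crisp_edge H u| <= #|crisp_edge G (val u)|)%N.
Proof.
move=> [_ mu_le]; rewrite -(card_image val_inj).
apply/subset_leq_card/subsetP=> _ /imageP[v /andP[neq_uv mu_gt0] ->].
by apply/andP; split; rewrite ?(inj_eq val_inj) ?(lt_le_trans mu_gt0) ?mu_le.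
Qed.

(** Both densities are compared with the degree [d]: it bounds the density of
    [H] from above and is the density of [G]. *)
Theorem star_balanced_regular (R : realType) (V : finType)
    (G : fuzzy_graph R V) (c : R) (d : nat) :
    strong G -> sigma_constant G c -> (forall u, #|crisp_edge G u| = d) ->
  star_balanced G.
Proof.
move=> strongG sigma_c deg W H subHG.
rewrite (@star_density_regular _ _ G c d) //.
apply: star_density_le_degree => u.
by rewrite -(deg (val u)) crisp_degree_subgraph.
Qed.

(** The map [val] identifies the neighbours of [A] with the 2-subsets of the
    complement of [A], which has three elements. *)
Lemma card_petersen_edge (A : petersen_vertex) : #|petersen_edge A| = 3%N.
Proof.
have cardC : #|~: val A| = 3%N.
  by rewrite cardsCs setCK card_ord (eqP (valP A)).
rewrite -(card_image val_inj).
transitivity #|[set B : {set 'I_5} | B \subset ~: val A & #|B| == 2]|.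
  2: by rewrite cards_draws cardC.
apply: eq_card => B; rewrite inE; apply/imageP/andP => [[B' disjAB ->]|[]].
  by split; [rewrite -disjoints_subset disjoint_sym | exact: (valP B')].
move=> subBA cardB; exists (Sub B cardB) => //.
by rewrite /in_mem /= /petersen_edge disjoint_sym disjoints_subset.
Qed.

Lemma card_edge_isomorphic (V1 V2 : finType) (e1 : rel V1) (e2 : rel V2)
    (f : V1 -> V2) u :
    bijective f -> (forall v w, e2 (f v) (f w) = e1 v w) ->
  #|e1 u| = #|e2 (f u)|.
Proof.
move=> bij_f edge_f; rewrite -(on_card_preimset (onW_bij _ bij_f)).
by apply: eq_card => v; rewrite inE /in_mem /= edge_f.
Qed.

Theorem theorem10 (R : realType) (V : finType) (P10 : fuzzy_graph R V) (c : R)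
    (hstrong : strong P10)
    (hpetersen : is_petersen (crisp_edge P10))
    (hconst : sigma_constant P10 c) :
  star_balanced P10.
Proof.
have [f bij_f edge_f] := hpetersen.
apply: (@star_balanced_regular _ _ _ c 3) => // u.
by rewrite (card_edge_isomorphic _ bij_f edge_f) card_petersen_edge.
Qed.
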